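(* Let $S$ be a finite set of alternatives, $V=\{1,\dots,N\}$ a finite set of voters, and $f:\Pi_S^V\to\Pi_S$ a clerical-dictatorial social welfare function. Then $f$ satisfies Independence of Irrelevant Alternatives.
   Context: $\Pi_S$ denotes the set of complete transitive binary relations (weak preferences) on $S$; for $R\in\Pi_S$ we write $x\le_R y$ for $(x,y)\in R$, and $x<_R y$, $x=_R y$ have the obvious meanings. A configuration is ${\bf R}=(R_1,\dots,R_N)\in\Pi_S^V$. A social welfare function (SWF) is any map $f:\Pi_S^V\to\Pi_S$ (for any finite voter set $V$, possibly empty). Independence of Irrelevant Alternatives (IIA): whenever ${\bf P},{\bf Q}\in\Pi_S^V$ agree (for every voter) on the pair $\{x,y\}$, $f({\bf P})$ and $f({\bf Q})$ agree on $\{x,y\}$. $f$ is null if $x=_{f({\bf R})}y$ for all ${\bf R}$ and all $x,y$. $f$ is dictatorial with dictator $i$ if either for all $x,y,{\bf R}$: $x\le_{f({\bf R})}y\Rightarrow x\le_{R_i}y$, or for all $x,y,{\bf R}$: $x\le_{f({\bf R})}y\Rightarrow y\le_{R_i}x$. For ${\bf R}\in\Pi_S^V$, ${\bf R}_{-i}\in\Pi_S^{V\setminus\{i\}}$ is its restriction to voters other than $i$. A dictatorial $f$ with dictator $i$ defers to $g:\Pi_S^{V\setminus\{i\}}\to\Pi_S$ over $i$ if for all $x,y\in S$ and ${\bf R}$ with $x=_{R_i}y$: $x\le_{f({\bf R})}y\iff x\le_{g({\bf R}_{-i})}y$. $f$ is clerical with cleric $C\in\Pi_S$ if for all $x,y,{\bf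 R}$: $x\le_{f({\bf R})}y\Rightarrow x\le_C y$. For $A\subseteq S$, the restriction $f|_A:\Pi_A^V\to\Pi_A$ is defined by: given ${\bf R}\in\Pi_A^V$ pick any ${\bf R}'\in\Pi_S^V$ agreeing with ${\bf R}$ on all pairs in $A$, and set $x\le_{f|_A({\bf R})}y$ iff $x\le_{f({\bf R}')}y$ for $x,y\in A$; $f|_A$ is well defined if this does not depend on the choice of ${\bf R}'$. Clerical-dictatorial (recursive definition): $f:\Pi_S^V\to\Pi_S$ is clerical-dictatorial if it is null, or $|S|\le 2$, or there is a cleric $C\in\Pi_S$ such that (1) $f$ is clerical with cleric $C$, and (2) for every equivalence class $A$ of $C$: (a) $f|_A$ is well defined and is null, dictatorial, or $|A|=2$; (b) if $f|_A$ is dictatorial (with dictator $j$) then it defers over $j$ to a clerical-dictatorial function $\Pi_A^{V\setminus\{j\}}\to\Pi_A$. *)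

(* Defs.v *)
From HB Require Import structures.
From mathcomp Require Import all_boot.

Set Implicit Arguments.
Unset Strict Implicit.
Unset Printing Implicit Defensive.

Definition complete_rel (S : finType) (R : {set S * S}) : bool :=
  [forall x, forall y, ((x, y) \in R) || ((y, x) \in R)].

Definition transitive_rel (S : finType) (R : {set S * S}) : bool :=
  [forall x, forall y, forall z,
    ((x, y) \in R) ==> ((y, z) \in R) ==> ((x, z) \in R)].

Record pref (S : finType) := Pref {
  pref_rel : {set S * S};
  pref_wf : complete_rel pref_rel && transitive_rel pref_rel
}.

HB.instance Definition _ (S : finType) := [isSub for @pref_rel S].

Definition le (S : finType) (R : pref S) (x y : S) : bool :=
  (x, y) \in pref_rel R.

Definition tie (S : finType) (R : pref S) (x y : S) : bool :=
  le R x y && le R y x.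

Lemma le_total (S : finType) (R : pref S) (x y : S) : le R x y || le R y x.
Proof. by have /andP[/forallP/(_ x)/forallP/(_ y)] := pref_wf R. Qed.

Lemma le_trans (S : finType) (R : pref S) (x y z : S) :
  le R x y -> le R y z -> le R x z.
Proof.
have /andP[_ /forallP/(_ x)/forallP/(_ y)/forallP/(_ z)] := pref_wf R.
by move=> /implyP H xy yz; exact: (implyP (H xy) yz).
Qed.

Definition rel_set (S : finType) (r : rel S) : {set S * S} :=
  [set p | r p.1 p.2].

Lemma rel_set_wf (S : finType) (r : rel S) :
  (forall x y, r x y || r y x) -> (forall x y z, r x y -> r y z -> r x z) ->
  complete_rel (rel_set r) && transitive_rel (rel_set r).
Proof.
move=> rT rtr; apply/andP; split.
  by apply/forallP=> x; apply/forallP=> y; rewrite !inE /=.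
apply/forallP=> x; apply/forallP=> y; apply/forallP=> z; rewrite !inE /=.
by apply/implyP=> xy; apply/implyP; exact: rtr xy.
Qed.

Definition profile (V S : finType) := {ffun V -> pref S}.

Definition SWF (V S : finType) := profile V S -> pref S.

Definition agree_pair (S : finType) (P Q : pref S) (x y : S) : Prop :=
  le P x y = le Q x y /\ le P y x = le Q y x.

Definition IIA (V S : finType) (f : SWF V S) : Prop :=
  forall (P Q : profile V S) (x y : S),
    (forall i, agree_pair (P i) (Q i) x y) -> agree_pair (f P) (f Q) x y.

Definition is_null (V S : finType) (f : SWF V S) : Prop :=
  forall (R : profile V S) (x y : S), tie (f R) x y.

Definition dictator (V S : finType) (f : SWF V S) (i : V) : Prop :=
  (forall (x y : S) (R : profile V S), le (f R) x y -> le (R i) x y) \/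
  (forall (x y : S) (R : profile V S), le (f R) x y -> le (R i) y x).

Definition dictatorial (V S : finType) (f : SWF V S) : Prop :=
  exists i : V, dictator f i.

Definition others (V : finType) (i : V) : finType := {j : V | j != i}.

Definition drop_voter (V S : finType) (R : profile V S) (i : V) :
  profile (others i) S := [ffun j : others i => R (val j)].

Definition defers (V S : finType) (f : SWF V S) (i : V)
    (g : SWF (others i) S) : Prop :=
  dictator f i /\
  forall (x y : S) (R : profile V S), tie (R i) x y ->
    (le (f R) x y <-> le (g (drop_voter R i)) x y).

Definition clerical (V S : finType) (f : SWF V S) (C : pref S) : Prop :=
  forall (x y : S) (R : profile V S), le (f R) x y -> le C x y.

Definition eq_class (S : finType) (C : pref S) (A : {set S}) : Prop :=
  exists a : S, A = [set x | tie C x a].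

Definition alts (S : finType) (A : {set S}) : finType := {x : S | x \in A}.

Definition agree_on (S : finType) (A : {set S}) (R : pref (alts A))
    (R' : pref S) : Prop :=
  forall a b : alts A, le R' (val a) (val b) = le R a b.

Definition agree_on_profile (V S : finType) (A : {set S})
    (R : profile V (alts A)) (R' : profile V S) : Prop :=
  forall i : V, agree_on (R i) (R' i).

Definition restr_well_defined (V S : finType) (f : SWF V S) (A : {set S}) :
    Prop :=
  forall (R : profile V (alts A)) (R1 R2 : profile V S),
    agree_on_profile R R1 -> agree_on_profile R R2 ->
    forall a b : alts A,
      le (f R1) (val a) (val b) = le (f R2) (val a) (val b).

(* One particular extension to S of a preference on A: the alternatives
   outside A are tied with each other and lie above all of A.  It serves as
   the arbitrary choice of R' in the definition of f|_A. *)
Definition extend_rel (S : finType) (A : {set S}) (R : pref (alts A)) :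
    rel S :=
  fun x y => match insub x : option (alts A), insub y : option (alts A) with
             | Some a, Some b => le R a b
             | _, None => true
             | None, Some _ => false
             end.

Lemma extend_wf (S : finType) (A : {set S}) (R : pref (alts A)) :
  complete_rel (rel_set (extend_rel R)) &&
  transitive_rel (rel_set (extend_rel R)).
Proof.
apply: rel_set_wf => [x y|x y z]; rewrite /extend_rel.
  by case: (insub x) (insub y) => [a|] [b|] //; exact: le_total.
case: (insub x) (insub y) (insub z) => [a|] [b|] [c|] //; exact: le_trans.
Qed.

Definition extend (S : finType) (A : {set S}) (R : pref (alts A)) : pref S :=
  Pref (extend_wf R).

Lemma extend_agree (S : finType) (A : {set S}) (R : pref (alts A)) :
  agree_on R (extend R).
Proof. by move=> a b; rewrite /le inE /= /extend_rel !valK. Qed.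

Definition sub_rel (S : finType) (A : {set S}) (R : pref S) : rel (alts A) :=
  fun a b => le R (val a) (val b).

Lemma sub_wf (S : finType) (A : {set S}) (R : pref S) :
  complete_rel (rel_set (@sub_rel S A R)) &&
  transitive_rel (rel_set (@sub_rel S A R)).
Proof.
by apply: rel_set_wf => [x y|x y z]; [exact: le_total | exact: le_trans].
Qed.

Definition sub_pref (S : finType) (A : {set S}) (R : pref S) :
  pref (alts A) := Pref (sub_wf A R).

(* f|_A; meaningful when restr_well_defined f A holds, see restrE. *)
Definition restr (V S : finType) (f : SWF V S) (A : {set S}) :
  SWF V (alts A) :=
  fun R => sub_pref A (f [ffun i => extend (R i)]).

Arguments restr {V S} f A R.

Lemma restrE (V S : finType) (f : SWF V S) (A : {set S}) :
  restr_well_defined f A ->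
  forall (R : profile V (alts A)) (R' : profile V S), agree_on_profile R R' ->
  forall a b : alts A, le (restr f A R) a b = le (f R') (val a) (val b).
Proof.
move=> wd R R' RR' a b; rewrite {1}/le inE /= /sub_rel.
by apply: (wd R) => // i; rewrite ffunE; exact: extend_agree.
Qed.

(* The recursion removes a voter at each step, so the inductive (least)
   reading is the unique solution of the recursive definition. *)
Inductive clerical_dictatorial : forall V S : finType, SWF V S -> Prop :=
| CD_null (V S : finType) (f : SWF V S) :
    is_null f -> clerical_dictatorial f
| CD_small (V S : finType) (f : SWF V S) :
    #|S| <= 2 -> clerical_dictatorial f
| CD_cleric (V S : finType) (f : SWF V S) (C : pref S) :
    clerical f C ->
    (forall A : {set S}, eq_class C A ->
      restr_well_defined f A /\
      (is_null (restr f A) \/ dictatorial (restr f A) \/ #|A| = 2)) ->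
    (forall A : {set S}, eq_class C A ->
      forall j : V, dictator (restr f A) j ->
      exists g : SWF (others j) (alts A),
        defers (restr f A) g /\ clerical_dictatorial g) ->
    clerical_dictatorial f.

(* Main.v *)
(** A pair that the cleric, or a dictator, does not tie is ranked by them alone:
    one of the two weak inequalities is excluded, and completeness forces the
    other. A pair tied by the cleric lies in one of its classes, so IIA of [f]
    reduces to IIA of its restrictions to classes; a pair tied by a dictator is
    ranked by the function deferred to, which has one voter fewer. *)

Require Import Defs.
From HB Require Import structures.
From mathcomp Require Import all_boot.

Lemma le_refl (S : finType) (R : pref S) (x : S) : le R x x.
Proof. by have := le_total R x x; rewrite orbb. Qed.

Lemma pref_ext (S : finType) (P Q : pref S) : le P =2 le Q -> P = Q.
Proof. by move=> PQ; apply/val_inj/setP=> -[x y]; exact: PQ. Qed.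

Lemma agree_pairC (S : finType) (P Q : pref S) (x y : S) :
  agree_pair P Q x y -> agree_pair P Q y x.
Proof. by case. Qed.

Lemma agree_pair_strict (S : finType) (P Q : pref S) (x y : S) :
  ~~ le P x y -> ~~ le Q x y -> agree_pair P Q x y.
Proof.
move=> nP nQ; split; first by rewrite (negbTE nP) (negbTE nQ).
have := le_total P x y; have := le_total Q x y.
by rewrite (negbTE nP) (negbTE nQ) /= => -> ->.
Qed.

Lemma IIA_null (V S : finType) (f : SWF V S) : is_null f -> IIA f.
Proof.
move=> f0 P Q x y _; rewrite /agree_pair.
by have /andP[-> ->] := f0 P x y; have /andP[-> ->] := f0 Q x y.
Qed.

(** When [x] and [y] differ they exhaust [S], so profiles agreeing on this pair are equal, the
    diagonal being fixed by reflexivity. *)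
Lemma IIA_card_le2 (V S : finType) (f : SWF V S) : #|S| <= 2 -> IIA f.
Proof.
move=> S2 P Q x y PQ; have [<-|xy] := eqVneq x y; first by split; rewrite !le_refl.
have Sxy z : (z == x) || (z == y).
  apply: contraLR S2; rewrite negb_or -ltnNge => /andP[zx zy].
  have <- : #|[set z; x; y]| = 3.
    by rewrite -setUA cardsU1 cards2 !inE negb_or zx zy xy.
  exact: max_card.
suff -> : P = Q by [].
apply/ffunP=> i; apply: pref_ext => a b; have [xyE yxE] := PQ i.
by case/orP: (Sxy a) => /eqP->; case/orP: (Sxy b) => /eqP->; rewrite ?le_refl.
Qed.

Lemma IIA_defers (V S : finType) (f : SWF V S) (j : V) (g : SWF (others j) S) :
  defers f g -> IIA g -> IIA f.
Proof.
move=> [dict defer] gI P Q x y PQ; have [Pxy Pyx] := PQ j.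
(* Since [P] and [Q] agree at [j], the dictator ties the pair in both profiles or in neither. *)
have [tP|] := boolP (tie (P j) x y).
  have tQ : tie (Q j) x y by rewrite /tie -Pxy -Pyx.
  have fE (R : profile V S) u v :
      tie (R j) u v -> le (f R) u v = le (g (drop_voter R j)) u v.
    by move=> t; apply/idP/idP => /(defer _ _ _ t).
  rewrite /agree_pair !fE // 1?/tie 1?andbC //.
  by apply: gI => i; rewrite !ffunE; exact: PQ.
(* Four cases: which inequality fails for [j], and whether [f] follows or reverses [j]. Reversal
   swaps the inequality excluded for [f]. *)
rewrite negb_and => /orP[n|n]; case: dict => d.
- by apply: agree_pair_strict; apply/negP => /d; rewrite -?Pxy (negbTE n).
- apply/agree_pairC/agree_pair_strict; apply/negP => /d;
    by rewrite -?Pxy (negbTE n).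
- apply/agree_pairC/agree_pair_strict; apply/negP => /d;
    by rewrite -?Pyx (negbTE n).
- by apply: agree_pair_strict; apply/negP => /d; rewrite -?Pyx (negbTE n).
Qed.

(** [R] is itself an extension of its restriction to [A], so well-definedness allows it in place of
    the canonical extension. *)
Lemma le_restr_sub (V S : finType) (f : SWF V S) (A : {set S})
    (R : profile V S) (a b : alts A) :
  restr_well_defined f A ->
  le (restr f A [ffun i => sub_pref A (R i)]) a b = le (f R) (val a) (val b).
Proof. by move=> wd; apply: restrE => // i u v; rewrite ffunE [RHS]inE. Qed.

Lemma IIA_clerical (V S : finType) (f : SWF V S) (C : pref S) :
  clerical f C ->
  (forall A : {set S}, eq_class C A ->
    restr_well_defined f A /\ IIA (restr f A)) ->
  IIA f.
Proof.
move=> fC fA P Q x y PQ; have [txy|] := boolP (tie C x y); last first.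
  rewrite negb_and => /orP[n|n]; last apply: agree_pairC;
    by apply: agree_pair_strict; apply: contra n => /fC.
pose A := [set z | tie C z y].
have xA : x \in A by rewrite inE.
have yA : y \in A by rewrite inE /tie le_refl.
have [wd rI] := fA A (ex_intro _ y erefl).
pose a : alts A := exist _ x xA; pose b : alts A := exist _ y yA.
(* Restricting each voter to the class keeps the agreement on the pair. *)
have := rI [ffun i => sub_pref A (P i)] [ffun i => sub_pref A (Q i)] a b.
rewrite /agree_pair !le_restr_sub //; apply=> i; rewrite !ffunE.
by have [e1 e2] := PQ i; split; rewrite /le !inE /= /sub_rel.
Qed.

Theorem theorem8 (S V : finType) (f : SWF V S) :
  clerical_dictatorial f -> IIA f.
Proof.
(* The generated induction principle ignores the occurrence under [exists];
   [have] is opaque to the guard checker, hence [case] on [fD]. *)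
move: V S f; fix IH 4 => _ _ _ [V S f f0 | V S f S2 | V S f C fC fA fD].
- exact: IIA_null.
- exact: IIA_card_le2.
apply: (IIA_clerical _ _ _ C) => // A CA; have [wd cases] := fA A CA.
split=> //; case: cases => [r0|[[j dj]|A2]].
- exact: IIA_null.
- by case: (fD A CA j dj) => g [fg gCD]; apply: IIA_defers fg (IH _ _ _ gCD).
- by apply: IIA_card_le2; rewrite card_sig A2.
Qed.
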